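(* Let $p\ge5$ be a prime with $p\equiv 2 \pmod 3$. Let $J\in\mathbb{F}_p$ with $J\neq\pm2,-1$, and put $C=3J^2-4$, $D=9J^3-36J-28$. The Vieta graph of the cubic $x^2+y^2+z^2=xyz-C(x+y+z)+D$ over $\mathbb{F}_p$ satisfies the following. (a) If $J^2\neq 4/3$: there are $p^2+1+2\sigma(J^2-4)p$ vertices in total, of which $3(p-4)$ are deficient; there are $3(p-5)$ vertices of degree $2$, $3$ of degree $1$, and $0$ of degree $0$. (b) If $J^2=4/3$: there are $p^2+1-2\sigma(2)p$ vertices in total, of which $3(p-3)$ are deficient; there are $3(p-3)$ vertices of degree $2$, $0$ of degree $1$, and $0$ of degree $0$.
   Context: $\sigma:\mathbb{F}_p\to\{-1,0,1\}\subset\mathbb{Z}$ denotes the quadratic character: $\sigma(a)=1$ if $a$ is a nonzero square, $\sigma(a)=-1$ if $a$ is a non-square, $\sigma(0)=0$. The Vieta graph of the equation $x^2+y^2+z^2=xyz-C(x+y+z)+D$ over $\mathbb{F}_p$ is the finite simple graph whose vertices are the solutions $(x,y,z)\in\mathbb{F}_p^3$, where two distinct vertices are joined by an edge whenever one is a Vieta flip of the other. The Vieta flips of $(x,y,z)$ are $(yz-C-x,y,z)$, $(x,xz-C-y,z)$, $(x,y,xy-C-z)$. Every vertex has degree at most $3$; a vertex is deficient if its degree is less than $3$. *)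

(* Defs.v *)
From mathcomp Require Import all_boot all_order all_algebra.

Set Implicit Arguments.
Unset Strict Implicit.
Unset Printing Implicit Defensive.

Import GRing.Theory.
Local Open Scope ring_scope.

Definition quadratic_char (F : finFieldType) (a : F) : int :=
  if a == 0 then 0 else if [exists b : F, a == b ^+ 2] then 1 else -1.

Definition on_cubic (F : finFieldType) (C D : F) (v : F * F * F) : bool :=
  let: (x, y, z) := v in
  x ^+ 2 + y ^+ 2 + z ^+ 2 == x * y * z - C * (x + y + z) + D.

Definition vieta_flips (F : finFieldType) (C : F) (v : F * F * F) :
    seq (F * F * F) :=
  let: (x, y, z) := v in
  [:: (y * z - C - x, y, z); (x, x * z - C - y, z); (x, y, x * y - C - z)].

Definition vieta_vertex (F : finFieldType) (C D : F) : finType :=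
  {v : F * F * F | on_cubic C D v}.

Definition vieta_adj (F : finFieldType) (C D : F) :
    rel (vieta_vertex C D) :=
  fun u v =>
    (u != v) && ((val v \in vieta_flips C (val u))
                 || (val u \in vieta_flips C (val v))).

Definition degree (T : finType) (e : rel T) (v : T) : nat :=
  #|[set w | e v w]|.

Definition deficient (T : finType) (e : rel T) (v : T) : bool :=
  (degree e v < 3)%N.

Definition num_degree (T : finType) (e : rel T) (d : nat) : nat :=
  #|[set v | degree e v == d]|.

Definition num_deficient (T : finType) (e : rel T) : nat :=
  #|[set v | deficient e v]|.

(* Main.v *)
Require Import Defs.
From mathcomp Require Import all_boot all_order all_algebra.
From mathcomp Require Import all_field ring zify.

Set Implicit Arguments.
Unset Strict Implicit.
Unset Printing Implicit Defensive.

Import GRing.Theory.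
Local Open Scope ring_scope.

(* Cut the surface by the planes of constant z: each section is a conic, whose
   number of points is given by the quadratic character, and for z <> -2 its
   determinant is, up to factors, disc_cubic at 1 / (z + 2). For the given C and
   D that cubic is an affine function of a cube (3 (J + 2) s - 1) ^ 3, and cubing
   is a bijection because p = 2 mod 3; hence exactly one section is singular, and
   the quadratic character sums to 0 over the values of disc_cubic.

   A vertex has degree 3 minus the number of flips fixing it. The fixed points of
   one flip form a genus 1 curve, a double cover of the z-line branched at z = -2
   and at the zeros of disc_cubic, so p - 3 of them are affine. A point fixed by two flips is the
   center of the singular section, so there is one for each pair of flips, unless
   C = 0, when the singular section is at z = 2 and has no center. A point fixed
   by all three flips would be singular on the surface, which is smooth. *)

(** * Indicator sums over finite types *)

Lemma card_sumz (T : finType) (P : pred T) :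
  #|[set x | P x]|%:Z = \sum_x (P x : nat)%:Z.
Proof.
rewrite -sum1_card big_mkcond /= -natz natr_sum; apply: eq_bigr => x _.
by rewrite inE natz; case: (P x).
Qed.

Lemma sumz_eq (T : finType) (a : T) (P : pred T) :
  \sum_x ((x == a) && P x : nat)%:Z = (P a : nat)%:Z.
Proof.
rewrite (bigD1 a) //= eqxx big1 ?addr0 // => x /negbTE->.
by [].
Qed.

Lemma sumz1 (T : finType) : \sum_(x : T) (1 : int) = #|T|%:Z.
Proof. by rewrite sumr_const natz. Qed.

(** * Quadratic character sums in odd characteristic *)

Section QuadraticCharacter.

Variable F : finFieldType.
Hypothesis two_neq0 : 2 != 0 :> F.
Local Notation sg := (@quadratic_char F).
Implicit Types a b c x y u : F.

Lemma four_neq0 : 4 != 0 :> F.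
Proof. by rewrite (_ : 4 = 2 * 2) ?mulf_neq0 //; ring. Qed.

Lemma qchar0 : sg 0 = 0.
Proof. by rewrite /quadratic_char eqxx. Qed.

Lemma qchar_sqr b : b != 0 -> sg (b ^+ 2) = 1.
Proof.
move=> b0; rewrite /quadratic_char sqrf_eq0 (negbTE b0).
by case: existsP => // -[]; exists b.
Qed.

Lemma qchar_neq0 a : a != 0 -> sg a = 1 \/ sg a = -1.
Proof.
by rewrite /quadratic_char => /negbTE->; case: ifP; [left | right].
Qed.

Lemma qcharMsqr b a : b != 0 -> sg (b ^+ 2 * a) = sg a.
Proof.
move=> b0; rewrite /quadratic_char mulf_eq0 sqrf_eq0 (negbTE b0) /=.
case: ifP => // _; congr (if _ then _ else _).
apply/existsP/existsP => -[c /eqP e].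
  by exists (c / b); rewrite expr_div_n -e mulrAC mulfV ?mul1r ?sqrf_eq0.
by exists (b * c); rewrite e exprMn.
Qed.

Lemma sqrt_count a : \sum_y (y ^+ 2 == a : nat)%:Z = 1 + sg a.
Proof.
rewrite /quadratic_char; case: (eqVneq a 0) => [->|a0].
  rewrite (bigD1 0) //= expr0n eqxx big1 // => y y0.
  by rewrite sqrf_eq0 (negbTE y0).
case: existsP => [[b /eqP e]|ne]; last first.
  by rewrite big1 // => y _; case: eqP => // e; case: ne; exists y; rewrite e.
have b0 : b != 0 by apply: contraNneq a0 => b0; rewrite e b0 expr0n.
have bN : - b != b.
  by rewrite -subr_eq0 -opprD oppr_eq0 -mulr2n -mulr_natl mulf_neq0.
rewrite (bigD1 b) //= (bigD1 (- b)) //= sqrrN e eqxx big1 // => y.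
by rewrite eqf_sqr => /andP[/negbTE-> /negbTE->].
Qed.

(** Double count of the pairs with y ^+ 2 = x: each y lies in one pair, each x in [1 + sg x]
    pairs. *)
Lemma sum_qchar : \sum_x sg x = 0.
Proof.
have: \sum_x (1 + sg x) = #|F|%:Z.
  under eq_bigr => x _ do rewrite -sqrt_count.
  rewrite exchange_big /= -sumz1; apply: eq_bigr => y _.
  rewrite (bigD1 (y ^+ 2)) //= eqxx big1 // => x /negbTE.
  by rewrite eq_sym => ->.
by rewrite big_split /= sumz1 -[RHS]addr0 => /addrI.
Qed.

Lemma sum_qchar_affine b c : b != 0 -> \sum_x sg (b * x + c) = 0.
Proof.
move=> b0; rewrite -[RHS]sum_qchar [RHS](reindex_inj (h := fun x => b * x + c)) //.
by move=> x y /addIr /mulfI; apply.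
Qed.

(* For a nonsquare a, every term of the sum of sg x + sg (a x) = 0 is
   nonpositive, so all of them vanish. *)
Lemma qcharM a b : sg (a * b) = sg a * sg b.
Proof.
case: (eqVneq a 0) => [->|a0]; first by rewrite mul0r qchar0 mul0r.
case: (eqVneq b 0) => [->|b0]; first by rewrite mulr0 qchar0 mulr0.
have sq x : sg x = 1 -> exists2 c, c != 0 & x = c ^+ 2.
  rewrite /quadratic_char; case: (eqVneq x 0) => // x0.
  case: existsP => // -[c /eqP e] _; exists c => //.
  by apply: contraNneq x0 => c0; rewrite e c0 expr0n.
case: (qchar_neq0 a0) => ea.
  by have [c c0 ->] := sq _ ea; rewrite qcharMsqr // qchar_sqr // mul1r.
case: (qchar_neq0 b0) => eb.
  by have [c c0 ->] := sq _ eb; rewrite mulrC qcharMsqr // qchar_sqr // mulr1.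
have le x : 0 <= - (sg x + sg (a * x)).
  case: (eqVneq x 0) => [->|x0]; first by rewrite mulr0 qchar0.
  case: (qchar_neq0 x0) => ex.
    by have [c c0 ->] := sq _ ex; rewrite qchar_sqr // mulrC qcharMsqr // ea.
  by rewrite ex; case: (qchar_neq0 (mulf_neq0 a0 x0)) => ->.
have := @Num.Theory.psumr_eq0P _ _ predT (fun x => - (sg x + sg (a * x)))
  (fun x _ => le x).
rewrite sumrN big_split /= sum_qchar.
under eq_bigr => x _ do rewrite -[a * x]addr0.
rewrite sum_qchar_affine // => /(_ (erefl _) b isT) /eqP.
by rewrite oppr_eq0 eb ea => /eqP e; rewrite -[LHS](addKr (-1)) e.
Qed.

Lemma linear_root_count b c : b != 0 ->
  \sum_y (b * y + c == 0 : nat)%:Z = 1.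
Proof.
move=> b0; rewrite (bigD1 (- c / b)) //= mulrC divfK // addNr eqxx.
rewrite big1 // => y; rewrite -(can2_eq (mulfK b0) (divfK b0)).
by rewrite mulrC addr_eq0 => /negbTE->.
Qed.

(** Completing the square turns the roots into square roots of the discriminant. *)
Lemma root_count a b c : a != 0 ->
  \sum_y (a * y ^+ 2 + b * y + c == 0 : nat)%:Z = 1 + sg (b ^+ 2 - 4 * a * c).
Proof.
move=> a0; rewrite -sqrt_count.
rewrite [RHS](reindex_inj (h := fun y => 2 * a * y + b)) /=; last first.
  by move=> x y /addIr /mulfI; apply; rewrite mulf_neq0.
apply: eq_bigr => y _; congr (Posz (nat_of_bool _)).
rewrite -[RHS]subr_eq0.
rewrite (_ : _ - _ = 4 * a * (a * y ^+ 2 + b * y + c)); last by ring.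
by rewrite !mulf_eq0 (negbTE four_neq0) (negbTE a0).
Qed.

(** Counts the points of the hyperbola y ^+ 2 = u ^+ 2 - d, brought to the form r u = d by factoring
    u ^+ 2 - y ^+ 2. *)
Lemma sum_qchar_sqrB d :
  \sum_u sg (u ^+ 2 - d) = (d == 0 : nat)%:Z * #|F|%:Z - 1.
Proof.
have: \sum_u (1 + sg (u ^+ 2 - d)) = (d == 0 : nat)%:Z * #|F|%:Z + #|F|%:Z - 1.
  under eq_bigr => u _ do rewrite -sqrt_count.
  have -> : \sum_u \sum_y (y ^+ 2 == u ^+ 2 - d : nat)%:Z
    = \sum_u \sum_r (r * u == d : nat)%:Z.
    transitivity (\sum_u \sum_r (r * (2 * u - r) == d : nat)%:Z).
      apply: eq_bigr => u _.
      rewrite (reindex_inj (h := fun r => u - r)) /=; last first.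
        by move=> x y /addrI /oppr_inj.
      apply: eq_bigr => r _; congr (Posz (nat_of_bool _)).
      by rewrite -subr_eq0 -[RHS]subr_eq0 -oppr_eq0; congr (_ == _); ring.
    rewrite exchange_big [RHS]exchange_big /=; apply: eq_bigr => r _.
    rewrite [RHS](reindex_inj (h := fun u => 2 * u - r)) //=.
    by move=> x y /addIr /mulfI; apply.
  (* The value u = 0 gives q pairs if d = 0 and none otherwise; each other u gives one pair. *)
  rewrite (bigD1 0) //=.
  rewrite (eq_bigr (fun=> (d == 0 : nat)%:Z)); last first.
    by move=> r _; rewrite mulr0 eq_sym.
  rewrite sumr_const -[_ *+ _]mulr_natr natz -addrA; congr (_ + _).
  rewrite (eq_bigr (fun=> 1)) => [|u u0].
    by rewrite -sumz1 [in RHS](bigD1 0) //= addrAC subrr add0r.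
  rewrite (bigD1 (d / u)) //= divfK // eqxx big1 // => r.
  by rewrite -(can2_eq (mulfK u0) (divfK u0)) => /negbTE->.
rewrite big_split /= sumz1 => e; apply: (addrI (#|F|%:Z)); rewrite e; ring.
Qed.

Lemma sum_qchar_quadratic a b c : a != 0 ->
  \sum_x sg (a * x ^+ 2 + b * x + c) =
    sg a * ((b ^+ 2 - 4 * a * c == 0 : nat)%:Z * #|F|%:Z - 1).
Proof.
move=> a0; rewrite -sum_qchar_sqrB mulr_sumr.
rewrite [RHS](reindex_inj (h := fun y => 2 * a * y + b)) /=; last first.
  by move=> x y /addIr /mulfI; apply; rewrite mulf_neq0.
apply: eq_bigr => x _; rewrite -qcharM.
rewrite (_ : a * (_ - _) = (2 * a) ^+ 2 * (a * x ^+ 2 + b * x + c)); last by ring.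
by rewrite qcharMsqr // mulf_neq0.
Qed.

End QuadraticCharacter.

(** * Cubing in a field of order 2 modulo 3 *)

Section CubeBijective.

Variable F : finFieldType.
Hypothesis card_mod3 : #|F| = 2 %[mod 3].

(** For q = 3 m + 2 the power 2 m + 1 inverts cubing: since x ^ q = x, the power 6 m + 3 = q + (3 m
    + 1) of x equals its power 3 m + 2 = q. *)
Lemma cube_inj : injective (fun x : F => x ^+ 3).
Proof.
have [m cardE] : exists m, #|F| = (3 * m + 2)%N.
  by exists (#|F| %/ 3)%N; rewrite {1}(divn_eq #|F| 3) card_mod3 mulnC.
have cubeK (x : F) : (x ^+ 3) ^+ (2 * m + 1) = x.
  have: x ^+ #|F| * x ^+ (3 * m + 1) = x ^+ #|F|.
    by rewrite {1}expf_card -exprS cardE; congr (_ ^+ _); lia.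
  rewrite -exprM -exprD expf_card => {2}<-; congr (_ ^+ _); lia.
by move=> x y /= e; rewrite -[x]cubeK e cubeK.
Qed.

(* A square root b of -3 would give the nontrivial cube root of unity
   (b - 1) / 2. *)
Lemma qcharN3 : 2 != 0 :> F -> 3 != 0 :> F ->
  @quadratic_char F (-3) = -1.
Proof.
move=> two0 three0; rewrite /quadratic_char oppr_eq0 (negbTE three0).
case: existsP => // -[b /eqP e].
have /cube_inj/(congr1 (fun x => x * 2)) : ((b - 1) / 2) ^+ 3 = 1 ^+ 3.
  rewrite expr_div_n expr1n.
  have -> : (b - 1) ^+ 3 = (b - 3) * b ^+ 2 + 3 * b - 1 by ring.
  by rewrite -e; field; rewrite (_ : 8 = 2 * 2 * 2) ?mulf_neq0 //; ring.
rewrite divfK // mul1r => /(canRL (subrK _)) eb.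
(* b = 3 would give -3 = 9, hence 12 = 0. *)
by move: e; rewrite eb => /eqP; rewrite -subr_eq0 (_ : _ - _ = - (2 * 2 * 3));
  rewrite ?oppr_eq0 ?mulf_eq0 ?(negbTE two0) ?(negbTE three0) //; ring.
Qed.

End CubeBijective.

(** * Vertex degrees through fixed points of the flips *)

Section VietaDegree.

Variables (F : finFieldType) (C D : F).

Definition fixed1 (v : F * F * F) := let: (x, y, z) := v in 2 * x == y * z - C.
Definition fixed2 (v : F * F * F) := let: (x, y, z) := v in 2 * y == x * z - C.
Definition fixed3 (v : F * F * F) := let: (x, y, z) := v in 2 * z == x * y - C.

(** A flip exchanges the two roots of the surface equation, which is a monic quadratic in each
    coordinate. *)
Lemma vieta_flips_on_cubic v u :
  on_cubic C D v -> u \in vieta_flips C v -> on_cubic C D u.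
Proof.
case: v => [[x y] z] /= /eqP e; rewrite !inE => /or3P[] /eqP-> /=; apply/eqP;
  apply/eqP; rewrite -subr_eq0; move/eqP: e; rewrite -subr_eq0 => /eqP <-;
  apply/eqP; ring.
Qed.

Lemma vieta_flips_sym u v :
  u \in vieta_flips C v -> v \in vieta_flips C u.
Proof.
by case: v => [[x y] z]; rewrite !inE => /or3P[] /eqP-> /=;
  rewrite !inE !xpair_eqE !subKr ?eqxx ?orbT.
Qed.

(** Flips of different coordinates that move the vertex lead to different neighbors. *)
Lemma degree_vieta (v : vieta_vertex C D) :
  degree (@vieta_adj F C D) v =
    (~~ fixed1 (val v) + ~~ fixed2 (val v) + ~~ fixed3 (val v))%N.
Proof.
rewrite /degree -(card_imset _ val_inj).
have -> : val @: [set w | vieta_adj v w] =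
  [set u in [seq u <- vieta_flips C (val v) | u != val v]].
  apply/setP => u; rewrite inE mem_filter; apply/imsetP/andP.
    case=> w; rewrite inE => /andP[ne /orP[] h ->]; split=> //;
      rewrite ?(inj_eq val_inj) 1?eq_sym //; exact: vieta_flips_sym.
  case=> ne h; have hu := vieta_flips_on_cubic (valP v) h.
  exists (Sub u hu : vieta_vertex C D); rewrite ?SubK // inE /vieta_adj SubK h.
  by rewrite andbT -(inj_eq val_inj) SubK eq_sym.
case: (val v) => [[x y] z]; rewrite cardsE /fixed1 /fixed2 /fixed3.
have f a b : (2 * a == b) = (b - a == a) by rewrite subr_eq mulr_natl mulr2n eq_sym.
rewrite !f /= !xpair_eqE !eqxx !andbT /=.
have h (s : seq (F * F * F)) n : uniq s -> size s = n -> #|s| = n.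
  by move=> /card_uniqP ->.
case: (eqVneq (y * z - C - x) x) => ex; case: (eqVneq (x * z - C - y) y) => ey;
  case: (eqVneq (x * y - C - z) z) => ez; apply: h => //=;
  rewrite ?inE ?xpair_eqE ?eqxx ?andbT ?andbF ?orbF //=;
  rewrite ?(negbTE ex) ?(negbTE ey) ?(negbTE ez) //=
    ?[y == _]eq_sym ?[z == _]eq_sym ?(negbTE ey) ?(negbTE ez) ?andbF.
Qed.

Lemma card_vertexz (P : pred (F * F * F)) :
  #|[set v : vieta_vertex C D | P (val v)]|%:Z =
    \sum_u (on_cubic C D u && P u : nat)%:Z.
Proof.
rewrite -card_sumz -(card_imset _ val_inj); congr Posz; apply: eq_card => u.
rewrite inE; apply/imsetP/andP => [[v]|[hu pu]].
  by rewrite inE => pv ->; split=> //; exact: valP.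
by exists (Sub u hu); rewrite ?inE SubK.
Qed.

Lemma sum_triple (h : F * F * F -> int) :
  \sum_u h u = \sum_z \sum_y \sum_x h (x, y, z).
Proof.
transitivity (\sum_x \sum_y \sum_z h (x, y, z)).
  by rewrite !pair_bigA /=; apply: eq_bigr => [[[x y] z]].
rewrite exchange_big; under eq_bigr => y _ do rewrite exchange_big.
by rewrite exchange_big.
Qed.

Lemma on_cubic_swap12 x y z : on_cubic C D (y, x, z) = on_cubic C D (x, y, z).
Proof. by rewrite /=; congr (_ == _); ring. Qed.

Lemma on_cubic_swap23 x y z : on_cubic C D (x, z, y) = on_cubic C D (x, y, z).
Proof. by rewrite /=; congr (_ == _); ring. Qed.

End VietaDegree.

Local Arguments on_cubic : simpl never.

(** * Discriminants of the plane sections *)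

Section VietaSurface.

Variable F : finFieldType.
Hypotheses (two0 : 2 != 0 :> F) (three0 : 3 != 0 :> F).
Hypothesis card_mod3 : #|F| = 2 %[mod 3].
Variable J : F.
Hypotheses (J_neq2 : J != 2) (J_neqN2 : J != -2) (J_neqN1 : J != -1).
Local Notation sg := (@quadratic_char F).
Local Notation q := (#|F|%:Z).
Local Notation C := (3 * J ^+ 2 - 4).
Local Notation D := (9 * J ^+ 3 - 36 * J - 28).
(** The value of [section_disc] at z = -2; it is nonzero because J is not 2 or -2. *)
Local Notation K := (9 * (J ^+ 2 - 4) * (J + 2) ^+ 2).

(* The plane section at height z is a conic of discriminant z ^+ 2 - 4, singular
   for z + 2 != 0 exactly when section_disc z = 0. *)
Definition section_disc z := (z - 2) * (z ^+ 2 + C * z - D) + C ^+ 2.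

(* The cubic 4 K s ^+ 3 - 36 (J ^+ 2 - 4) (J + 2) s ^+ 2 - 12 (4 - J ^+ 2) s + 4,
   written as an affine function of a cube. *)
Definition disc_cubic s := 4 / 3 * ((J - 2) * (3 * (J + 2) * s - 1) ^+ 3 + (J + 1)).

Let four0 : 4 != 0 :> F := four_neq0 two0.

Lemma J2_neq4 : J ^+ 2 - 4 != 0.
Proof.
rewrite (_ : _ - _ = (J - 2) * (J + 2)); last by ring.
by rewrite mulf_neq0 // ?subr_eq0 // -[2]opprK subr_eq0.
Qed.

Lemma Jp2_neq0 : J + 2 != 0.
Proof. by rewrite -[2]opprK subr_eq0. Qed.

Lemma Jm2_neq0 : J - 2 != 0.
Proof. by rewrite subr_eq0. Qed.

Lemma K_neq0 : K != 0.
Proof.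
by rewrite (_ : 9 = 3 * 3) ?mulf_neq0 ?J2_neq4 ?sqrf_eq0 ?Jp2_neq0 //; ring.
Qed.

Lemma qcharK : sg K = sg (J ^+ 2 - 4).
Proof.
rewrite (_ : K = (3 * (J + 2)) ^+ 2 * (J ^+ 2 - 4)); last by ring.
by rewrite qcharMsqr // mulf_neq0 // Jp2_neq0.
Qed.

Lemma disc_cubicE s : disc_cubic s =
  4 * K * s ^+ 3 - 36 * (J ^+ 2 - 4) * (J + 2) * s ^+ 2 - 12 * (4 - J ^+ 2) * s + 4.
Proof. by rewrite /disc_cubic; field. Qed.

(** At a root z of [section_disc] this makes K (z - 2) (z + 2) a square. *)
Lemma four_section_disc z :
  4 * section_disc z = (z + 2) * (2 * (z - 2) + C) ^+ 2 - K * (z - 2).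
Proof. by rewrite /section_disc; ring. Qed.

Lemma section_disc_cubic z : z + 2 != 0 ->
  4 * section_disc z = (z + 2) ^+ 3 * disc_cubic (z + 2)^-1.
Proof. by move=> z0; rewrite four_section_disc disc_cubicE; field. Qed.

Let shift_inj : injective (fun s => 3 * (J + 2) * s - 1).
Proof. by move=> x y /addIr /mulfI; apply; rewrite mulf_neq0 ?Jp2_neq0. Qed.

Let cubic_inj : injective disc_cubic.
Proof.
have e : 4 / 3 != 0 :> F by rewrite mulf_neq0 ?invr_eq0.
by move=> x y /(mulfI e) /addIr /(mulfI Jm2_neq0) /(cube_inj card_mod3) /shift_inj.
Qed.

Lemma sum_qchar_disc_cubic : \sum_s sg (disc_cubic s) = 0.
Proof. by rewrite -[RHS](sum_qchar two0) [RHS](reindex_inj cubic_inj). Qed.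

(** [disc_cubic] is injective on a finite field, so it has one zero s, and s != 0 since
    [disc_cubic 0] is 4. The root is then z = 1 / s - 2. *)
Lemma section_disc_root : exists z0, forall z, (section_disc z == 0) = (z == z0).
Proof.
have [h _ hK] := injF_bij cubic_inj.
have s0 : h 0 != 0.
  apply/eqP => e; have := hK 0; rewrite e (_ : disc_cubic 0 = 4).
    by apply/eqP.
  by rewrite disc_cubicE; ring.
have eK : section_disc (-2) != 0.
  have e : 4 * section_disc (-2) = 4 * K by rewrite four_section_disc; ring.
  by rewrite (mulfI four0 e) K_neq0.
exists ((h 0)^-1 - 2) => z; case: (eqVneq (z + 2) 0) => [z2|z2].
  have zE : z = -2 by apply/eqP; rewrite -addr_eq0 z2.
  by rewrite zE (negbTE eK) eq_sym subr_eq addNr invr_eq0 (negbTE s0).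
have -> : (section_disc z == 0) = (disc_cubic (z + 2)^-1 == 0).
  transitivity (4 * section_disc z == 0); first by rewrite mulf_eq0 (negbTE four0).
  by rewrite section_disc_cubic // mulf_eq0 expf_eq0 (negbTE z2).
rewrite -[X in _ == X]hK (inj_eq cubic_inj) eq_sym -subr_eq opprK.
by rewrite -(inj_eq (@invr_inj F)) invrK eq_sym.
Qed.

(** * Point count by plane sections *)

Lemma on_cubic_quadratic x y z : on_cubic C D (x, y, z) =
  (1 * y ^+ 2 + (C - z * x) * y + (x ^+ 2 + C * x + (z ^+ 2 + C * z - D)) == 0).
Proof. by rewrite /on_cubic -subr_eq0; congr (_ == _); ring. Qed.

(** The argument of [sg] is the discriminant in y of the surface equation, so the section at height
    z has [q + conic_sum z] points. *)
Definition conic_sum z := \sum_x sg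
  ((z ^+ 2 - 4) * x ^+ 2 + (- (2 * C * (z + 2))) * x
   + (C ^+ 2 - 4 * (z ^+ 2 + C * z - D))).

Lemma card_cubic_conic_sum :
  \sum_u (on_cubic C D u : nat)%:Z = q ^+ 2 + \sum_z conic_sum z.
Proof.
rewrite sum_triple -[q ^+ 2]/(q * q) -{1}(sumz1 F) mulr_suml -big_split /=.
apply: eq_bigr => z _; rewrite exchange_big mul1r -sumz1 -big_split /=.
apply: eq_bigr => x _; under eq_bigr => y _ do rewrite on_cubic_quadratic.
by rewrite root_count ?oner_neq0 //; congr (1 + sg _); ring.
Qed.

Lemma conic_sum_generic z : z ^+ 2 - 4 != 0 ->
  conic_sum z = sg (z ^+ 2 - 4) * ((section_disc z == 0 : nat)%:Z * q - 1).
Proof.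
move=> z4; rewrite /conic_sum sum_qchar_quadratic //.
have z2 : z + 2 != 0.
  apply: contraNneq z4 => /eqP; rewrite addr_eq0 => /eqP->; apply/eqP; ring.
have -> : (- (2 * C * (z + 2))) ^+ 2
    - 4 * (z ^+ 2 - 4) * (C ^+ 2 - 4 * (z ^+ 2 + C * z - D))
  = 4 * 4 * (z + 2) * section_disc z by rewrite /section_disc; ring.
by rewrite !mulf_eq0 (negbTE four0) (negbTE z2).
Qed.

Lemma conic_sumN2 : conic_sum (-2) = q * sg K.
Proof.
rewrite /conic_sum (eq_bigr (fun=> sg K)); last by move=> x _; congr sg; ring.
by rewrite sumr_const -[LHS]mulr_natl natz.
Qed.

(** The section is a parabola: the discriminant in y is affine in x. *)
Lemma conic_sum2 : C != 0 -> conic_sum 2 = 0.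
Proof.
move=> C0; rewrite -(sum_qchar_affine two0
  (C ^+ 2 - 4 * (2 ^+ 2 + C * 2 - D)) (b := - (4 * 2 * C))) ?oppr_eq0 ?mulf_neq0 //.
by rewrite /conic_sum; apply: eq_bigr => x _; congr sg; ring.
Qed.

Lemma conic_sum2_C0 : C = 0 -> conic_sum 2 = - q * sg 2.
Proof.
move=> C0; rewrite /conic_sum (eq_bigr (fun=> - sg 2)); last first.
  move=> x _; rewrite -[RHS]mulN1r -(qcharN3 card_mod3) // -qcharM //.
  (* When 3 J ^+ 2 = 4, the summand is [sg] of -6 times the square of 2 (J + 2). *)
  rewrite -[RHS](qcharMsqr (b := 2 * (J + 2))) ?mulf_neq0 ?Jp2_neq0 //.
  congr sg; apply/eqP; rewrite -subr_eq0; apply/eqP.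
  by transitivity (C * (- (8 * x) + C + 12 * J)); [ring | rewrite C0 mul0r].
by rewrite sumr_const -[LHS]mulr_natl natz mulrN mulNr.
Qed.

(** Here 9 (J ^+ 2 - 4) = -24 = 4 (-3) 2, and -3 is a nonsquare. *)
Lemma qcharK_C0 : C = 0 -> sg (J ^+ 2 - 4) = - sg 2.
Proof.
move=> C0; rewrite -[RHS]mulN1r -(qcharN3 card_mod3) // -qcharM //.
rewrite -(qcharMsqr (b := 3)) // -[RHS](qcharMsqr (b := 2)) //.
congr sg; apply/eqP; rewrite -subr_eq0; apply/eqP.
by transitivity (C * 3); [ring | rewrite C0 mul0r].
Qed.

Lemma card_cubic : \sum_u (on_cubic C D u : nat)%:Z =
  q ^+ 2 + 1 + 2 * sg (J ^+ 2 - 4) * q.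
Proof.
have [z0 z0P] := section_disc_root.
have N22 : -2 != 2 :> F by rewrite -subr_eq0 (_ : _ - _ = - 4) ?oppr_eq0 //; ring.
(* The generic value vanishes at z = 2 and z = -2, so the exceptional values can simply be added. *)
have eqz z : conic_sum z = sg (z ^+ 2 - 4) * ((z == z0 : nat)%:Z * q - 1)
   + (z == 2 : nat)%:Z * conic_sum 2 + (z == -2 : nat)%:Z * conic_sum (-2).
  have z4 : (z ^+ 2 - 4 == 0) = (z == 2) || (z == -2).
    rewrite (_ : _ - _ = (z - 2) * (z - - 2)); last by ring.
    by rewrite mulf_eq0 !subr_eq0.
  case: (eqVneq z 2) z4 => [->|_] /=.
    by move=> /eqP->; rewrite qchar0 [2 == -2]eq_sym (negbTE N22) !mul0r mul1r add0r addr0.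
  case: (eqVneq z (-2)) => [->|_] /=.
    by move=> /eqP->; rewrite qchar0 !mul0r mul1r add0r.
  by move=> /negbT z4; rewrite conic_sum_generic // z0P !mul0r !addr0.
have pick (a : F) (h : F -> int) : \sum_z (z == a : nat)%:Z * h z = h a.
  rewrite (bigD1 a) //= eqxx mul1r big1 ?addr0 // => z /negbTE->.
  by rewrite mul0r.
rewrite card_cubic_conic_sum.
have -> : \sum_z conic_sum z = q * sg (z0 ^+ 2 - 4) + 1 + conic_sum 2 + q * sg K.
  rewrite (eq_bigr (fun z => (z == z0 : nat)%:Z * (q * sg (z ^+ 2 - 4))
    - sg (z ^+ 2 - 4) + (z == 2 : nat)%:Z * conic_sum 2
    + (z == -2 : nat)%:Z * conic_sum (-2))).
    rewrite !big_split /= sumrN !pick sum_qchar_sqrB // (negbTE four0) mul0r.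
    by rewrite conic_sumN2; ring.
  by move=> z _; rewrite eqz; ring.
rewrite qcharK; case: (eqVneq C 0) => C0.
  (* For C = 0 the singular height is z0 = 2, and its contribution comes from [conic_sum 2]
     instead. *)
  have e2 : section_disc 2 == 0 by rewrite /section_disc C0 subrr mul0r add0r expr0n.
  rewrite conic_sum2_C0 // qcharK_C0 //; move: e2; rewrite z0P => /eqP <-.
  rewrite (_ : 2 ^+ 2 - 4 = 0) ?qchar0; last by ring.
  by ring.
have e0 : section_disc z0 = 0 by apply/eqP; rewrite z0P.
have z02 : z0 - 2 != 0.
  apply: contra_neq C0 => e; apply/eqP; rewrite -sqrf_eq0; apply/eqP.
  by move: e0; rewrite /section_disc e mul0r add0r.
have := four_section_disc z0; rewrite e0 mulr0 => /esym/eqP; rewrite subr_eq0.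
move=> /eqP e4.
have z0C : 2 * (z0 - 2) + C != 0.
  apply/eqP => e; move: e4; rewrite e expr0n /= mulr0 => /esym/eqP.
  by apply/negP; rewrite mulf_neq0 ?K_neq0.
have z0X : z0 + 2 != 0.
  apply/eqP => e; move: e4; rewrite e mul0r => /esym/eqP.
  by apply/negP; rewrite mulf_neq0 ?K_neq0.
(* Multiplying [e4] by z0 + 2 exhibits a nonzero square, so the singular section contributes the
   same as z = -2. *)
have : sg (K * (z0 ^+ 2 - 4)) = 1.
  rewrite -(@qchar_sqr _ ((z0 + 2) * (2 * (z0 - 2) + C))) ?mulf_neq0 //.
  congr sg; rewrite (_ : z0 ^+ 2 - 4 = (z0 - 2) * (z0 + 2)); last by ring.
  by rewrite mulrA -e4; ring.
rewrite qcharM // qcharK conic_sum2 //.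
have [->|->] := qchar_neq0 J2_neq4; last first.
  by rewrite mulN1r => /(canRL (@opprK _)) ->; ring.
by rewrite mul1r => ->; ring.
Qed.


(** * Points fixed by one flip *)

(* The discriminant in x of the equation of the surface: the first flip exchanges
   the two roots in x, and fixes exactly the double ones. *)
Definition fixed_quartic y z := (y + 2) * (z + 2) * ((y - 2) * (z - 2) - 2 * C) + K.

Lemma on_cubic_fixed1 x y z : on_cubic C D (x, y, z) && fixed1 C (x, y, z) =
  (x == (y * z - C) / 2) && (fixed_quartic y z == 0).
Proof.
rewrite /fixed1 andbC [2 * x]mulrC (can2_eq (mulfK two0) (divfK two0)).
case: eqP => //= ->; rewrite /on_cubic -subr_eq0.
rewrite (_ : fixed_quartic y z = - 4 * (((y * z - C) / 2) ^+ 2 + y ^+ 2 + z ^+ 2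
  - ((y * z - C) / 2 * y * z - C * ((y * z - C) / 2 + y + z) + D))).
  by rewrite mulf_eq0 oppr_eq0 (negbTE four0).
by rewrite /fixed_quartic; field.
Qed.

(* In y, fixed_quartic has discriminant (2 (z + 2) ^+ 2) ^+ 2 times the value of
   disc_cubic at (z + 2)^-1. At z = -2, where this inverse is 0, and at z = 2,
   where the leading coefficient vanishes, the last two terms correct the count. *)
Lemma fixed_quartic_count z : \sum_y (fixed_quartic y z == 0 : nat)%:Z =
  1 + sg (disc_cubic (z + 2)^-1) - (z == 2 : nat)%:Z - 2 * (z == -2 : nat)%:Z.
Proof.
case: (eqVneq z 2) => [->|z2].
  have N22 : 2 != -2 :> F by rewrite -subr_eq0 opprK -natrD.
  have X0 : 2 + 2 != 0 :> F by rewrite -natrD.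
  have: 4 * C ^+ 2 = (2 + 2) ^+ 3 * disc_cubic (2 + 2)^-1.
    by rewrite -section_disc_cubic // /section_disc subrr mul0r add0r.
  move=> e; rewrite (negbTE N22) mulr0 subr0.
  have -> : disc_cubic (2 + 2)^-1 = (C / 4) ^+ 2.
    apply: (mulfI (expf_neq0 3 X0)); rewrite -e; field.
    by rewrite four0.
  (* At z = 2 the quartic is affine in y with slope -8 C: one root if C != 0, none if C = 0. *)
  case: (eqVneq C 0) => C0.
    rewrite C0 mul0r expr0n qchar0 big1 // => y _.
    by rewrite /fixed_quartic C0 subrr !mulr0 subr0 mulr0 add0r (negbTE K_neq0).
  rewrite qchar_sqr ?mulf_neq0 ?invr_eq0 // addrK.
  rewrite -(linear_root_count (b := - (4 * 2 * C)) (K - 4 * 4 * C)); last first.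
    by rewrite oppr_eq0 !mulf_neq0.
  apply: eq_bigr => y _.
  by rewrite /fixed_quartic; congr (Posz (nat_of_bool (_ == 0))); ring.
case: (eqVneq z (-2)) => [->|zN2].
  rewrite addNr invr0 (_ : disc_cubic 0 = 2 ^+ 2); last by rewrite disc_cubicE; ring.
  rewrite qchar_sqr // big1 // => y _.
  by rewrite /fixed_quartic addNr mulr0 mul0r add0r (negbTE K_neq0).
have X0 : z + 2 != 0 by rewrite -[2]opprK subr_eq0.
have z20 : z - 2 != 0 by rewrite subr_eq0.
rewrite mulr0 !subr0 -(qcharMsqr (b := 2 * (z + 2) ^+ 2)) ?mulf_neq0 ?sqrf_eq0 //.
rewrite (_ : _ * disc_cubic _ = 16 * (z + 2) * section_disc z); last first.
  transitivity (4 * (z + 2) * ((z + 2) ^+ 3 * disc_cubic (z + 2)^-1)).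
    by ring.
  by rewrite -section_disc_cubic //; ring.
rewrite (_ : 16 * (z + 2) * section_disc z = (- (2 * C * (z + 2))) ^+ 2
  - 4 * ((z - 2) * (z + 2)) * (K - 4 * (z + 2) * (z - 2 + C))); last first.
  by rewrite /section_disc; ring.
rewrite -root_count ?mulf_neq0 //; apply: eq_bigr => y _.
by rewrite /fixed_quartic; congr (Posz (nat_of_bool (_ == 0))); ring.
Qed.

(** With 0 inverted to 0, z |-> 1 / (z + 2) permutes the field, so the character sum is that of
    [disc_cubic], namely 0; the corrections at 2 and -2 subtract 3. *)
Lemma card_fixed1 :
  \sum_u (on_cubic C D u && fixed1 C u : nat)%:Z = q - 3.
Proof.
rewrite sum_triple (eq_bigr (fun z => 1 + sg (disc_cubic (z + 2)^-1)
  - (z == 2 : nat)%:Z - 2 * (z == -2 : nat)%:Z)); last first.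
  move=> z _; rewrite -fixed_quartic_count; apply: eq_bigr => y _.
  rewrite -(sumz_eq ((y * z - C) / 2) (fun=> fixed_quartic y z == 0)).
  by apply: eq_bigr => x _; rewrite on_cubic_fixed1.
rewrite !big_split /= !sumrN -mulr_sumr sumz1.
have pick (a : F) : \sum_z (z == a : nat)%:Z = 1.
  by rewrite (bigD1 a) //= eqxx big1 // => z /negbTE->.
have -> : \sum_z sg (disc_cubic (z + 2)^-1) = 0.
  rewrite -[RHS]sum_qchar_disc_cubic.
  rewrite [RHS](reindex_inj (h := fun z => (z + 2)^-1)) //.
  by move=> x y /invr_inj /addIr.
by rewrite !pick; ring.
Qed.

Lemma card_fixed2 :
  \sum_u (on_cubic C D u && fixed2 C u : nat)%:Z = q - 3.
Proof.
rewrite -card_fixed1 (reindex_inj (h := fun u => (u.1.2, u.1.1, u.2))) /=.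
  by apply: eq_bigr => [[[x y] z]] _; rewrite /= on_cubic_swap12.
by move=> [[x y] z] [[x' y'] z'] [-> -> ->].
Qed.

Lemma card_fixed3 :
  \sum_u (on_cubic C D u && fixed3 C u : nat)%:Z = q - 3.
Proof.
rewrite -card_fixed2 (reindex_inj (h := fun u => (u.1.1, u.2, u.1.2))) /=.
  by apply: eq_bigr => [[[x y] z]] _; rewrite /= on_cubic_swap23.
by move=> [[x y] z] [[x' y'] z'] [-> -> ->].
Qed.

(** * Points fixed by two or three flips *)

Lemma on_cubic_fixed12 x y z :
  on_cubic C D (x, y, z) && (fixed1 C (x, y, z) && fixed2 C (x, y, z)) =
    [&& x == y, (z - 2) * x == C, section_disc z == 0 & C != 0].
Proof.
have sdE : (z - 2) * x = C -> section_disc z =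
    (z - 2) * (x ^+ 2 + x ^+ 2 + z ^+ 2 - (x * x * z - C * (x + x + z) + D)).
  by rewrite /section_disc => <-; ring.
rewrite /fixed1 /fixed2.
apply/idP/and4P => [/and3P[h1 /eqP f1 /eqP f2]|[/eqP <- /eqP e /eqP s C0]]; last first.
  have z2 : z - 2 != 0.
    by apply: contraNneq C0 => z2; rewrite -e z2 mul0r.
  have e2 : 2 * x == x * z - C by rewrite -e; apply/eqP; ring.
  rewrite e2 !andbT /on_cubic -subr_eq0; move/eqP: s; rewrite sdE //.
  by rewrite mulf_eq0 (negbTE z2).
(* At z = -2 the quartic is the nonzero constant K, so no point there is fixed by the first flip. *)
have zN2 : z + 2 != 0.
  have := on_cubic_fixed1 x y z; rewrite h1 /fixed1 f1 eqxx /= => /esym/andP[_].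
  rewrite /fixed_quartic; apply: contraTneq => ->.
  by rewrite mulr0 mul0r add0r K_neq0.
have exy : x = y.
  apply/eqP; rewrite -subr_eq0; have /eqP: (z + 2) * (x - y) = 0.
    rewrite (_ : _ * _ = z * (x - y) + (2 * x - 2 * y)); last by ring.
    by rewrite f1 f2; ring.
  by rewrite mulf_eq0 (negbTE zN2).
have e : (z - 2) * x = C.
  by rewrite (_ : _ * _ = x * z - 2 * x); [rewrite {2}exy f2; ring | ring].
have s : section_disc z = 0.
  move: h1; rewrite sdE // -exy /on_cubic -subr_eq0 => /eqP->.
  by rewrite mulr0.
(* If C = 0, the singular height is z = 2, where the surface equation with x = y becomes D = 4 and
   forces K = 0. *)
rewrite -exy eqxx e s !eqxx; split=> //.
apply/eqP => C0.
have [z0 z0P] := section_disc_root.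
have: section_disc 2 == 0 by rewrite /section_disc C0 subrr mul0r add0r expr0n.
move/eqP: s; rewrite !z0P => /eqP ez /eqP e2; move: h1.
rewrite -exy ez -e2 /on_cubic C0 mul0r subr0 => /eqP e4.
have := K_neq0; rewrite (_ : K = C * (C + 8) + 4 * (D - 4)); last by ring.
rewrite C0 mul0r add0r mulf_eq0 (negbTE four0) subr_eq0 => /eqP[].
by apply: (addrI (x * x * 2)); rewrite -e4; ring.
Qed.

Lemma card_fixed12 : \sum_u (on_cubic C D u && (fixed1 C u && fixed2 C u) : nat)%:Z =
  (C != 0 : nat)%:Z.
Proof.
have [z0 z0P] := section_disc_root.
(* The center of the singular section; for C = 0 both sides are 0. *)
rewrite -(sumz_eq (C / (z0 - 2), C / (z0 - 2), z0) (fun=> C != 0)).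
apply: eq_bigr => [[[x y] z]] _; congr (Posz (nat_of_bool _)).
rewrite on_cubic_fixed12 z0P !xpair_eqE.
case: (eqVneq C 0) => C0; first by rewrite !andbF.
have z02 : z0 - 2 != 0.
  apply: contra_neq C0 => z2; apply/eqP; rewrite -sqrf_eq0.
  have: section_disc z0 == 0 by rewrite z0P.
  by rewrite /section_disc z2 mul0r add0r.
rewrite !andbT; case: (eqVneq z z0) => [->|]; last by rewrite !andbF.
rewrite !andbT mulrC (can2_eq (mulfK z02) (divfK z02)) andbC.
by case: eqP => //= ->; rewrite eq_sym.
Qed.

Lemma card_fixed13 : \sum_u (on_cubic C D u && (fixed1 C u && fixed3 C u) : nat)%:Z =
  (C != 0 : nat)%:Z.
Proof.
rewrite -card_fixed12 (reindex_inj (h := fun u => (u.1.1, u.2, u.1.2))) /=.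
  apply: eq_bigr => [[[x y] z]] _.
  by rewrite /= on_cubic_swap23 [z * y]mulrC.
by move=> [[x y] z] [[x' y'] z'] [-> -> ->].
Qed.

Lemma card_fixed23 : \sum_u (on_cubic C D u && (fixed2 C u && fixed3 C u) : nat)%:Z =
  (C != 0 : nat)%:Z.
Proof.
rewrite -card_fixed13 (reindex_inj (h := fun u => (u.1.2, u.1.1, u.2))) /=.
  apply: eq_bigr => [[[x y] z]] _.
  by rewrite /= on_cubic_swap12 [y * x]mulrC.
by move=> [[x y] z] [[x' y'] z'] [-> -> ->].
Qed.

(* A point fixed by all three flips is a singular point of the surface. *)
Lemma no_fixed123 u :
  on_cubic C D u -> [&& fixed1 C u, fixed2 C u & fixed3 C u] = false.
Proof.
case: u => [[x y] z] h; apply/negP => /and3P[f1 f2 f3].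
have := on_cubic_fixed12 x y z; rewrite h f1 f2.
move=> /esym/and4P[/eqP exy /eqP eC _ _].
have f1' : fixed1 C (x, z, y) by rewrite /fixed1 [z * y]mulrC.
have f3' : fixed2 C (x, z, y) := f3.
have := on_cubic_fixed12 x z y; rewrite on_cubic_swap23 h f1' f3'.
move=> /esym/and4P[/eqP exz _ _ _]; move: h.
rewrite /on_cubic -exy -exz => h; rewrite -exz in eC => {f1 f2 f3 f1' f3' exy exz y z}.
(* Modulo (x - 2) x = C the surface equation becomes linear in x, with the factor 3 (J + 1), nonzero
   as J != -1. *)
have eJ : 2 * (J - 1) * (x - 1) = 3 * (J ^+ 2 - 2 * J - 2).
  have J1 : 3 * (J + 1) != 0 by rewrite mulf_neq0 // -[1]opprK subr_eq0.
  apply: (mulfI J1); apply/eqP; rewrite -subr_eq0; move: h; rewrite -subr_eq0.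
  move=> /eqP h; apply/eqP; transitivity ((x - 1) * ((x - 2) * x - C)
    + (x ^+ 2 + x ^+ 2 + x ^+ 2 - (x * x * x - C * (x + x + x) + D))); first by ring.
  by rewrite h eC subrr mulr0 addr0.
(* Squaring the linear equation and using (x - 1) ^+ 2 = C + 1 eliminates x and leaves K = 0. *)
have: K = 3 * ((2 * (J - 1) * (x - 1)) ^+ 2 - (3 * (J ^+ 2 - 2 * J - 2)) ^+ 2
   - 4 * (J - 1) ^+ 2 * ((x - 2) * x - C)) by ring.
by move/eqP; rewrite eJ eC !subrr mulr0 subr0 mulr0 (negbTE K_neq0).
Qed.

(** * Degree counts *)

Lemma card_degree (P : pred nat) :
  #|[set v | P (degree (@vieta_adj F C D) v)]|%:Z =
  \sum_u (on_cubic C D u && P (~~ fixed1 C u + ~~ fixed2 C u + ~~ fixed3 C u)%N : nat)%:Z.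
Proof.
rewrite -(card_vertexz C D (fun u => P (~~ fixed1 C u + ~~ fixed2 C u + ~~ fixed3 C u)%N)).
by congr Posz; apply: eq_card => v; rewrite !inE degree_vieta.
Qed.

Lemma card_vertices :
  #|vieta_vertex C D|%:Z = q ^+ 2 + 1 + 2 * sg (J ^+ 2 - 4) * q.
Proof.
rewrite -card_cubic -cardsT (_ : setT = [set v : vieta_vertex C D | true]).
  by rewrite (card_vertexz C D predT); under eq_bigr => u _ do rewrite andbT.
by apply/setP => v; rewrite !inE.
Qed.

Lemma num_degree0 : num_degree (@vieta_adj F C D) 0 = 0%N.
Proof.
apply/eqP; rewrite -eqz_nat (card_degree (pred1 0)) big1 // => u _.
case: (boolP (on_cubic C D u)) => //= /no_fixed123.
by case: (fixed1 C u); case: (fixed2 C u); case: (fixed3 C u).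
Qed.

(** Degree 1 means fixed by exactly two flips; the three pairs of flips have disjoint sets of fixed
    points. *)
Lemma num_degree1 : (num_degree (@vieta_adj F C D) 1)%:Z = 3 * (C != 0 : nat)%:Z.
Proof.
rewrite (card_degree (pred1 1%N)).
transitivity ((C != 0 : nat)%:Z + (C != 0 : nat)%:Z + (C != 0 : nat)%:Z); last by ring.
rewrite -{1}card_fixed12 -{1}card_fixed13 -card_fixed23 -!big_split.
apply: eq_bigr => u _; case: (boolP (on_cubic C D u)) => //= /no_fixed123.
by case: (fixed1 C u); case: (fixed2 C u); case: (fixed3 C u).
Qed.

(** Inclusion-exclusion over the three flips, with empty triple intersection. *)
Lemma num_deficientE : (num_deficient (@vieta_adj F C D))%:Z =
  3 * (q - 3) - 3 * (C != 0 : nat)%:Z.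
Proof.
rewrite (card_degree (fun d => d < 3)%N).
transitivity (((q - 3) + (q - 3) + (q - 3)) -
  ((C != 0 : nat)%:Z + (C != 0 : nat)%:Z + (C != 0 : nat)%:Z)); last by ring.
rewrite -{1}card_fixed1 -{1}card_fixed2 -card_fixed3.
rewrite -{1}card_fixed12 -{1}card_fixed13 -card_fixed23 -!big_split -sumrN -big_split.
apply: eq_bigr => u _; case: (boolP (on_cubic C D u)) => //= /no_fixed123.
by case: (fixed1 C u); case: (fixed2 C u); case: (fixed3 C u).
Qed.

Lemma num_degree2 : (num_degree (@vieta_adj F C D) 2)%:Z =
  3 * (q - 3) - 6 * (C != 0 : nat)%:Z.
Proof.
transitivity ((num_deficient (@vieta_adj F C D))%:Z
  - (num_degree (@vieta_adj F C D) 1)%:Z); last first.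
  by rewrite num_deficientE num_degree1; ring.
rewrite (card_degree (pred1 2%N)) (card_degree (pred1 1%N)).
rewrite (card_degree (fun d => d < 3)%N) -sumrN -big_split.
apply: eq_bigr => u _; case: (boolP (on_cubic C D u)) => //= /no_fixed123.
by case: (fixed1 C u); case: (fixed2 C u); case: (fixed3 C u).
Qed.

Lemma vieta_graph_C_neq0 : C != 0 -> (5 <= #|F|)%N ->
  [/\ #|vieta_vertex C D|%:Z = q ^+ 2 + 1 + 2 * sg (J ^+ 2 - 4) * q,
      num_deficient (@vieta_adj F C D) = (3 * (#|F| - 4))%N,
      num_degree (@vieta_adj F C D) 2 = (3 * (#|F| - 5))%N,
      num_degree (@vieta_adj F C D) 1 = 3%N
    & num_degree (@vieta_adj F C D) 0 = 0%N].
Proof.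
move=> C0 q5; move: card_vertices num_degree0 num_degree1 num_degree2 num_deficientE.
rewrite C0 /=; move: (num_deficient _) (num_degree _ 2) (num_degree _ 1).
(* The bound 5 <= q makes the truncated subtractions exact. *)
by move=> n n2 n1 ? ? e1 e2 e; split=> //; move: q5 e1 e2 e; lia.
Qed.

Lemma vieta_graph_C_eq0 : C = 0 -> (5 <= #|F|)%N ->
  [/\ #|vieta_vertex C D|%:Z = q ^+ 2 + 1 - 2 * sg 2 * q,
      num_deficient (@vieta_adj F C D) = (3 * (#|F| - 3))%N,
      num_degree (@vieta_adj F C D) 2 = (3 * (#|F| - 3))%N,
      num_degree (@vieta_adj F C D) 1 = 0%N
    & num_degree (@vieta_adj F C D) 0 = 0%N].
Proof.
move=> C0 q5; have Cb : (C != 0) = false by rewrite C0 eqxx.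
move: card_vertices num_degree0 num_degree1 num_degree2 num_deficientE.
rewrite Cb /=; move: (num_deficient _) (num_degree _ 2) (num_degree _ 1).
move=> n n2 n1 -> ? e1 e2 e; split=> //; move: q5 e1 e2 e; try lia.
by rewrite qcharK_C0 // mulrN mulNr.
Qed.

End VietaSurface.

(** * Specialization to prime fields *)

Theorem theorem14p2 (p : nat) (p_pr : prime p) (p_ge5 : (5 <= p)%N)
    (p_mod3 : p = 2 %[mod 3]) (J C D : 'F_p)
    (J_neq2 : J <> 2) (J_neqN2 : J <> -2) (J_neqN1 : J <> -1)
    (defC : C = 3 * J ^+ 2 - 4)
    (defD : D = 9 * J ^+ 3 - 36 * J - 28) :
  (J ^+ 2 <> 4 / 3 ->
    [/\ #|vieta_vertex C D|%:Z
          = p%:Z ^+ 2 + 1 + 2 * quadratic_char (J ^+ 2 - 4) * p%:Z,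
        num_deficient (@vieta_adj _ C D) = (3 * (p - 4))%N,
        num_degree (@vieta_adj _ C D) 2 = (3 * (p - 5))%N,
        num_degree (@vieta_adj _ C D) 1 = 3%N
      & num_degree (@vieta_adj _ C D) 0 = 0%N])
  /\
  (J ^+ 2 = 4 / 3 ->
    [/\ #|vieta_vertex C D|%:Z
          = p%:Z ^+ 2 + 1 - 2 * quadratic_char (2 : 'F_p) * p%:Z,
        num_deficient (@vieta_adj _ C D) = (3 * (p - 3))%N,
        num_degree (@vieta_adj _ C D) 2 = (3 * (p - 3))%N,
        num_degree (@vieta_adj _ C D) 1 = 0%N
      & num_degree (@vieta_adj _ C D) 0 = 0%N]).
Proof.
have small_neq0 n : (0 < n < 5)%N -> n%:R != 0 :> 'F_p.
  case/andP=> n0 n5; rewrite -(dvdn_pcharf (pchar_Fp p_pr)).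
  by apply/negP => /(dvdn_leq n0); lia.
have two0 := small_neq0 2%N isT; have three0 := small_neq0 3%N isT.
have cardF := card_Fp p_pr; rewrite -cardF in p_ge5 p_mod3.
move/eqP: J_neq2 => J2; move/eqP: J_neqN2 => JN2; move/eqP: J_neqN1 => JN1.
have CE : (C == 0) = (J ^+ 2 == 4 / 3).
  by rewrite defC subr_eq0 mulrC (can2_eq (mulfK three0) (divfK three0)).
subst C D; split=> [/eqP | /eqP]; rewrite -CE => C0.
  by have := vieta_graph_C_neq0 two0 three0 p_mod3 J2 JN2 JN1 C0 p_ge5; rewrite cardF.
have := vieta_graph_C_eq0 two0 three0 p_mod3 J2 JN2 JN1 (eqP C0) p_ge5.
by rewrite cardF.
Qed.
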